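(* Let $q\in\mathbb N$, let $\alpha_1,\dots,\alpha_{2q}$, $\beta_1,\dots,\beta_{2q}$, $x_1,\dots,x_{2q}$ be complex numbers, let $\Lambda$ be the associated block Vandermonde matrix of order $2q$, and for $1\le j,m\le2q$ let $M_{j,m}$ be the minor (determinant) obtained from $\Lambda$ by deleting row $j$ and column $m$. Fix $j\in[2q]$. If $1\le m\le q$, then $$M_{j,m}=\sum_{\substack{T\subseteq R_j\\ |T|=q-1}}\varepsilon_j(T)\left(\prod_{i\in T}\alpha_i\right)\left(\prod_{i\in T'}\beta_i\right)\det\left(V_T^{E_m}\right)\det(V_{T'}),$$ where $$\det\left(V_T^{E_m}\right)=\prod_{\substack{r<s\\ r,s\in T}}(x_s-x_r)\;e_{q-m}\left((x_t)_{t\in T}\right).$$ If $m=q+\ell$ with $1\le\ell\le q$, then $$M_{j,q+\ell}=\sum_{\substack{T\subseteq R_j\\ |T|=q}}\varepsilon_j(T)\left(\prod_{i\in T}\alpha_i\right)\left(\prod_{i\in T'}\beta_i\right)\det(V_T)\det\left(V_{T'}^{E_\ell}\right),$$ where $$\det\left(V_{T'}^{E_\ell}\right)=\prod_{\substack{r<s\\ r,s\in T'}}(x_s-x_r)\;e_{q-\ell}\left((x_t)_{t\in T'}\right).$$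
   Context: $[2q]=\{1,\dots,2q\}$. The block Vandermonde matrix of order $2q$ is the $2q\times2q$ matrix $\Lambda$ whose $i$-th row is $$(\alpha_i,\ \alpha_ix_i,\ \dots,\ \alpha_ix_i^{q-1},\ \beta_i,\ \beta_ix_i,\ \dots,\ \beta_ix_i^{q-1}),\qquad i=1,\dots,2q.$$ For $j\in[2q]$: $R_j:=[2q]\setminus\{j\}$ with its natural order; $\rho_j:R_j\to[2q-1]$ is the order isomorphism $\rho_j(i)=i$ for $i<j$, $\rho_j(i)=i-1$ for $i>j$. For $T=\{t_1<\cdots<t_s\}\subseteq R_j$ put $T':=R_j\setminus T$ and $$\varepsilon_j(T):=(-1)^{\sum_{k=1}^s(\rho_j(t_k)-k)}=(-1)^{\#\{(u,t)\in T'\times T:\,u<t\}}.$$ For $S=\{s_1<\cdots<s_d\}\subseteq[2q]$ and an exponent set $E=\{e_1<\cdots<e_d\}\subset\mathbb N_0$, $V_S^E:=(x_{s_i}^{e_k})_{1\le i,k\le d}$ is the generalized Vandermonde matrix, and $V_S:=V_S^{\{0,\dots,d-1\}}$ is the ordinary one. For $r=1,\dots,q$, $E_r:=\{0,1,\dots,q-1\}\setminus\{r-1\}$. $e_r(y_1,\dots,y_d)$ is the elementary symmetric polynomial of degree $r$, with $e_0=1$ and $e_r=0$ for $r<0$ or $r>d$; $e_r((x_t)_{t\in T})$ is that polynomial in the variables $x_t$, $t\in T$. Empty products and determinants of $0\times0$ matrices equal $1$. *)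

(* Defs.v *)
From mathcomp Require Import all_boot all_order all_algebra.
From mathcomp Require mpoly.
From mathcomp Require Import reals complex.

Set Implicit Arguments.
Unset Strict Implicit.
Unset Printing Implicit Defensive.

Import GRing.Theory.
Local Open Scope ring_scope.

(* Rows, columns and exponents are numbered from 0: the index i of the
   mathematical text is the ordinal of value i - 1. *)

(* Columns [lshift q k] carry alpha_i x_i^k, columns [rshift q k] carry
   beta_i x_i^k. *)
Definition block_vandermonde (C : comNzRingType) (q : nat)
    (alpha beta x : 'I_(q + q) -> C) : 'M[C]_(q + q) :=
  row_mx (\matrix_(i < q + q, k < q) (alpha i * x i ^+ k))
         (\matrix_(i < q + q, k < q) (beta i * x i ^+ k)).

Definition minor (C : comNzRingType) (n : nat) (A : 'M[C]_n) (j m : 'I_n) : C :=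
  \det (row' j (col' m A)).

Definition Rset (n : nat) (j : 'I_n) : {set 'I_n} := [set~ j].

(* [unbump j] is the order isomorphism from the complement of j onto an
   initial segment of nat: it fixes i < j and sends i > j to i - 1. *)
Definition rho (n : nat) (j i : 'I_n) : nat := unbump j i.

(* [enum_val] lists T in increasing order. Both rho and k are shifted by one
   with respect to the 1-based formula, so their difference is unchanged; for
   T inside [Rset j] the natural subtraction never truncates. *)
Definition eps (C : comNzRingType) (n : nat) (j : 'I_n) (T : {set 'I_n}) : C :=
  (-1) ^+ (\sum_(k < #|T|) (rho j (enum_val k) - k)%N).

(* The generalized Vandermonde matrix V_S^E, meant for #|S| = #|E|; [enum]
   lists both S and E in increasing order. *)
Definition gen_vandermonde (C : comNzRingType) (n b : nat) (x : 'I_n -> C)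
    (S : {set 'I_n}) (E : {set 'I_b}) : 'M[C]_#|S| :=
  \matrix_(i, k) x (enum_val i) ^+ nth 0%N [seq val e | e <- enum E] k.

Definition vandermonde (C : comNzRingType) (n : nat) (x : 'I_n -> C)
    (S : {set 'I_n}) : 'M[C]_#|S| :=
  gen_vandermonde x S [set: 'I_#|S|].

(* With r counted from 0, this is {0, ..., q-1} minus r. *)
Definition Eset (q : nat) (r : 'I_q) : {set 'I_q} := [set~ r].

Definition elem_sym (C : comNzRingType) (n : nat) (x : 'I_n -> C)
    (T : {set 'I_n}) (r : nat) : C :=
  mpoly.meval (fun i : 'I_#|T| => x (enum_val i)) (mpoly.mesym #|T| C r).

Definition diff_prod (C : comNzRingType) (n : nat) (x : 'I_n -> C)
    (T : {set 'I_n}) : C :=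
  \prod_(r in T) \prod_(s in T | (r < s)%N) (x s - x r).

(* Main.v *)
Require Import Defs.
From mathcomp Require Import all_boot all_order all_fingroup all_algebra.
From mathcomp Require Import reals complex.
From mathcomp Require Import zify.

(** Deleting row j and one column of the block Vandermonde matrix leaves a
    matrix whose rows are indexed by R_j and whose columns still fall into an
    alpha-block followed by a beta-block; the block that lost a column has a
    gap in its exponents. The expansion of the minor is the Laplace expansion
    along the columns of the alpha-block. It is read off the Leibniz formula:
    the permutations are sorted according to the set T of rows that they match
    with the alpha-columns ([det_sum_row_sets]). The permutations with a given T
    make up the determinant of the matrix in which only the entries of
    T x (alpha-columns) and T' x (beta-columns) are kept, and moving the rows
    of T to the top turns that matrix into a block-diagonal one
    ([det_shuffled_blocks]). The row permutation used is the shuffle attached to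
    T. Its sign is given by the parity of its inversions
    ([sign_perm_inversions]), which are the pairs (t, u) in T x T' with u < t;
    counting them by t gives the exponent of epsilon_j(T) ([epsE]). Row i of each block is alpha_i or beta_i times a row
    of powers of x_i, so these scalars come out as products.

    The determinants with a gap in their exponents come from an ordinary
    Vandermonde determinant with one more point, an indeterminate X
    ([det_vandermonde_gap]). It equals the product of the differences of the y_i
    times the product of the X - y_i; in its expansion along the powers of X the
    coefficient of X^r is, up to sign, the determinant without exponent r, and
    Vieta's formula gives the coefficient of X^r in the product of the X - y_i.

    The blocks are given by functions of a row index and a natural number
    rather than by matrices: their sizes, such as #|T| and q - 1, are equal only
    provably, and no transport between matrix types is then required. *)

Set Implicit Arguments.
Unset Strict Implicit.
Unset Printing Implicit Defensive.

Import GRing.Theory Num.Theory.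
Local Open Scope ring_scope.

(** * Signs of permutations and increasing enumerations *)

Lemma ltn_mono_inj (n p : nat) (h : 'I_n -> 'I_p) :
  {mono h : i k / (i < k)%N} -> injective h.
Proof.
move=> h_mono i k eq_h; apply: val_inj => /=.
by case: (ltngtP i k) => //; rewrite -h_mono eq_h ltnn.
Qed.

(** Permuting the points 0, ..., n-1 multiplies their Vandermonde determinant,
    which is positive, by the sign of s; in the product of the differences
    s j - s i, each inversion contributes one negative factor. *)
Lemma sign_perm_inversions (C : pzRingType) (n : nat) (s : 'S_n) :
  (-1) ^+ s = (-1) ^+ (\sum_(i < n) \sum_(j < n | (i < j)%N) (s j < s i)%N) :> C.
Proof.
set N := (\sum_(i < n) _)%N; rewrite -(signr_odd _ N); congr (_ ^+ nat_of_bool _).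
(* The two parities are compared through signs in int, where 1 and -1 differ. *)
apply: (@signr_inj int); rewrite signr_odd.
pose V (t : 'S_n) := Vandermonde n (\row_i (t i)%:Z).
have detV (t : 'S_n) : \det (V t) = \prod_(i < n) \prod_(j < n | (i < j)%N) ((t j)%:Z - (t i)%:Z).
  by rewrite det_Vandermonde; do 2![apply: eq_bigr => ? _]; rewrite !mxE.
have Vs : \det (V s) = (-1) ^+ s * \det (V 1%g).
  have -> : V s = col_perm s (V 1%g) by apply/matrixP=> i j; rewrite !mxE perm1.
  by rewrite col_permE det_mulmx det_perm odd_permV mulrC.
have V1 : Num.sg (\det (V 1%g)) = 1.
  apply: gtr0_sg; rewrite detV; do 2![apply: prodr_gt0 => ? ?].
  by rewrite !perm1 subr_gt0 ltz_nat.
have /(congr1 Num.sg) := Vs; rewrite sgrM V1 mulr1 sgrX sgrN1 => <-.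
rewrite detV /N -prodrXr (big_morph _ (@sgrM _) (sgr1 _)).
apply: eq_bigr => i _; rewrite -prodrXr (big_morph _ (@sgrM _) (sgr1 _)).
apply: eq_bigr => j lt_ij.
have : s j != s i by rewrite (inj_eq perm_inj) neq_ltn lt_ij orbT.
rewrite -val_eqE neq_ltn; case: ltngtP => // lt_s _.
  by rewrite ltr0_sg // subr_lt0 ltz_nat.
by rewrite gtr0_sg // subr_gt0 ltz_nat.
Qed.

Lemma enum_val_ltn (n : nat) (T : {set 'I_n}) :
  {mono (@enum_val _ T) : i k / (i < k)%N}.
Proof.
have homo : {homo (@enum_val _ T) : i k / (i < k)%N}.
  move=> i k lt_ik; have [y _] : exists y : 'I_n, y \in T by exists (enum_val i); apply: enum_valP.
  rewrite !(enum_val_nth y).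
  apply: (sorted_ltn_nth (leT := fun u v : 'I_n => (u < v)%N)) => //.
  - by move=> ? ? ?; apply: ltn_trans.
  - rewrite {1}/enum_mem sorted_filter //; first by move=> ? ? ?; apply: ltn_trans.
    rewrite -(@sorted_map _ _ val ltn) -enumT val_enum_ord; exact: iota_ltn_sorted.
  - by rewrite inE -cardE.
  - by rewrite inE -cardE.
move=> i k; case: (ltngtP i k) => [/homo ->//|/homo lt_ki|/val_inj ->].
  by apply/negbTE; rewrite -leqNgt ltnW.
by rewrite ltnn.
Qed.

(** * Laplace expansion along a block of columns *)

(** The Leibniz formula, its permutations s being grouped by the set T of rows
    that s sends into the columns L. In the summand of T, the entries at which
    membership of the row in T and of the column in L disagree are erased; this
    kills exactly the permutations of the other groups. Rows are named through h
    so that T is a subset of the index set of the matrix from which rows have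
    been removed. *)
Lemma det_sum_row_sets (C : comPzRingType) (n p : nat) (h : 'I_n -> 'I_p)
    (L : {set 'I_n}) (M : 'M[C]_n) :
  injective h ->
  \det M = \sum_(T : {set 'I_p} | (T \subset h @: [set: 'I_n]) && (#|T| == #|L|))
             \det (\matrix_(i, k) (M i k *+ ((h i \in T) == (k \in L)))).
Proof.
move=> h_inj.
rewrite {1}/determinant.
rewrite (partition_big (fun s : 'S_n => h @: (s @^-1: L))
  (fun T => (T \subset h @: [set: 'I_n]) && (#|T| == #|L|))) /=; last first.
  move=> s _; rewrite imsetS ?subsetT // card_imset //.
  by rewrite on_card_preimset ?eqxx //; exists (s^-1)%g => i _; rewrite ?permK ?permKV.
apply: eq_bigr => T /andP[/subsetP sTh _].
rewrite /determinant [RHS](bigID (fun s : 'S_n => h @: (s @^-1: L) == T)) /=.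
rewrite [X in _ = _ + X]big1 ?addr0 => [|s neqT].
  apply: eq_bigr => s /eqP <-; congr (_ * _); apply: eq_bigr => i _.
  by rewrite mxE mem_imset // inE eqxx.
have [i /negbTE Ni] : exists i, (h i \in T) != (s i \in L).
  apply/existsP; apply: contraNT neqT; rewrite negb_exists => /forallP eqT.
  apply/eqP/setP => t; apply/imsetP/idP => [[] i|tT].
    by rewrite inE => siL ->; have := eqT i; rewrite negbK siL => /eqP.
  have /imsetP[i _ def_t] := sTh t tT; exists i => //; rewrite inE.
  by have := eqT i; rewrite negbK -def_t tT => /eqP.
by rewrite (bigD1 i) //= !mxE Ni mul0r mulr0.
Qed.

(** Sorting the rows so that those of T come first makes the matrix
    block-diagonal. The set T' is a variable, not the complement of T in the
    image of h: an expression mentioning h would depend on n and prevent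
    the replacement of n by #|T| + #|T'|. *)
Lemma det_shuffled_blocks (C : comPzRingType) (n p : nat) (T T' : {set 'I_p})
    (h : 'I_n -> 'I_p) (A B : 'I_p -> nat -> C) :
  {mono h : i k / (i < k)%N} -> h @: [set: 'I_n] = T :|: T' ->
  [disjoint T & T'] ->
  \det (\matrix_(i < n, k < n)
     ((if (k < #|T|)%N then A (h i) k else B (h i) (k - #|T|)%N)
        *+ ((h i \in T) == (k < #|T|)%N))) =
  (-1) ^+ (\sum_(t in T) \sum_(u in T') (u < t)%N)
    * \det (\matrix_(i < #|T|, k < #|T|) A (enum_val i) k)
    * \det (\matrix_(i < #|T'|, k < #|T'|) B (enum_val i) k).
Proof.
move=> h_mono him disj.
have h_inj := ltn_mono_inj h_mono.
have def_n : n = (#|T| + #|T'|)%N.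
  by rewrite -[LHS]card_ord -cardsT -(card_imset _ h_inj) him cardsU disjoint_setI0 // cards0 subn0.
subst n.
(* The shuffle: the elements of T in increasing order, then those of T'. *)
pose f (k : 'I_(#|T| + #|T'|)) : 'I_p :=
  match split k with inl i => enum_val i | inr i => enum_val i end.
have fl k : f (lshift _ k) = enum_val k by rewrite /f -[lshift _ k]/(unsplit (inl k)) unsplitK.
have fr k : f (rshift _ k) = enum_val k by rewrite /f -[rshift _ k]/(unsplit (inr k)) unsplitK.
have f_im k : f k \in codom h.
  suff: f k \in h @: [set: _] by case/imsetP=> i _ ->; apply: codom_f.
  rewrite him inE /f; case: split => i; rewrite enum_valP ?orbT //.
have T'N u : u \in T' -> u \in T = false.
  by move=> uT'; apply/negP => uT; have /pred0P/(_ u) := disj; rewrite /= uT uT'.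
have f_inj : injective f.
  move=> i k; case: (split_ordP i) => {}i ->; case: (split_ordP k) => {}k ->; rewrite ?fl ?fr.
  - by move/enum_val_inj ->.
  - by move=> eq_ik; have := T'N _ (enum_valP k); rewrite -eq_ik enum_valP.
  - by move=> eq_ik; have := T'N _ (enum_valP i); rewrite eq_ik enum_valP.
  - by move/enum_val_inj ->.
pose s0 k := iinv (f_im k).
have hs0 k : h (s0 k) = f k by apply: f_iinv.
have s0_inj : injective s0 by move=> i k eq_s; apply: f_inj; rewrite -!hs0 eq_s.
pose s := perm s0_inj.
have hs k : h (s k) = f k by rewrite permE hs0.
set N := (X in \det X = _).
have det_s : \det N = (-1) ^+ s * \det (row_perm s N).
  by rewrite row_permE det_mulmx det_perm mulrA -signr_addb addbb mul1r.
have -> : (-1) ^+ (\sum_(t in T) \sum_(u in T') (u < t)%N) = (-1) ^+ s :> C.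
  (* The shuffle increases on each of the two blocks, so an inversion takes
     its first index in the block of T and its second in the block of T'. *)
  rewrite sign_perm_inversions; congr (_ ^+ _).
  rewrite big_split_ord /= [X in (_ = _ + X)%N]big1 ?addn0 => [|i _]; last first.
    rewrite big_mkcond big_split_ord /= big1 ?big1 // => k _.
      by rewrite ltn_add2l -h_mono !hs !fr enum_val_ltn; case: ltngtP.
    by rewrite ltnNge ltnW //= (leq_trans (ltn_ord k)) // leq_addr.
  rewrite big_enum_val; apply: eq_bigr => i _; rewrite big_enum_val.
  rewrite [RHS]big_mkcond big_split_ord /= [X in (_ = X + _)%N]big1 ?add0n => [|k _].
    by apply: eq_bigr => k _; rewrite (leq_trans (ltn_ord i)) ?leq_addr // -h_mono !hs fl fr.
  by rewrite -h_mono !hs !fl enum_val_ltn; case: ltngtP.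
rewrite det_s -mulrA; congr (_ * _).
rewrite -(det_ublock _ 0); congr (\det _); apply/matrixP => i k.
rewrite 2![LHS]mxE hs.
case: (split_ordP i) => {}i ->; case: (split_ordP k) => {}k ->;
  rewrite ?fl ?fr ?(block_mxEul, block_mxEur, block_mxEdl, block_mxEdr) !mxE /=.
- by rewrite enum_valP.
- by rewrite enum_valP.
- by rewrite T'N // enum_valP.
- by rewrite addKn T'N ?enum_valP // mulr1n.
Qed.

Lemma laplace_two_blocks (C : comPzRingType) (n p a : nat) (h : 'I_n -> 'I_p)
    (A B : 'I_p -> nat -> C) :
  {mono h : i k / (i < k)%N} -> (a <= n)%N ->
  let S := h @: [set: 'I_n] in
  \det (\matrix_(i < n, k < n)
          if (k < a)%N then A (h i) k else B (h i) (k - a)%N) =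
  \sum_(T : {set 'I_p} | (T \subset S) && (#|T| == a))
     (-1) ^+ (\sum_(t in T) \sum_(u in S :\: T) (u < t)%N)
       * \det (\matrix_(i < #|T|, k < #|T|) A (enum_val i) k)
       * \det (\matrix_(i < #|S :\: T|, k < #|S :\: T|) B (enum_val i) k).
Proof.
move=> h_mono le_an S.
have h_inj := ltn_mono_inj h_mono.
have cardL : #|[set k : 'I_n | (k < a)%N]| = a.
  by rewrite -sum1dep_card -(big_ord_widen _ (fun _ => 1%N)) // sum1_card card_ord.
rewrite (det_sum_row_sets [set k : 'I_n | (k < a)%N] _ h_inj) cardL.
apply: eq_bigr => T /andP[sTS /eqP cardT].
rewrite -(det_shuffled_blocks A B h_mono) -?/S; last first.
- by rewrite disjoint_sym disjoints_subset subsetDr.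
- by apply/setP => u; rewrite !inE; case: (boolP (u \in T)) => [/(subsetP sTS) ->|].
by congr (\det _); apply/matrixP => i k; rewrite !mxE inE cardT.
Qed.

(** * Vandermonde determinants with a missing exponent *)

(** The Vandermonde determinant of y_0, ..., y_(d-1) and an indeterminate, as
    last point, is computed in two ways, and coefficients of 'X^r are compared.
    [bump r] enumerates the exponents other than r. *)
Lemma det_vandermonde_gap (C : idomainType) (d : nat) (y : 'I_d -> C) (r : 'I_d.+1) :
  \det (\matrix_(i < d, k < d) y i ^+ bump r k) =
  \prod_(i < d) \prod_(k < d | (i < k)%N) (y k - y i)
    * mpoly.meval y (mpoly.mesym d C (d - r)).
Proof.
pose z : 'rV[{poly C}]_d.+1 :=
  \row_i (if unlift ord_max i is Some k then (y k)%:P else 'X).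
have zl (i : 'I_d) : z 0 (lift ord_max i) = (y i)%:P by rewrite mxE liftK.
have zm : z 0 ord_max = 'X by rewrite mxE unlift_none.
have zw (i : 'I_d) : z 0 (widen_ord (leqnSn d) i) = (y i)%:P.
  by rewrite -zl; congr (z 0 _); apply: val_inj; rewrite /= /bump leqNgt ltn_ord.
pose P := \prod_(i < d) \prod_(k < d | (i < k)%N) (y k - y i).
pose Q := \prod_(i < d) ('X - (y i)%:P).
have detPQ : \det (Vandermonde d.+1 z) = P *: Q.
  rewrite det_Vandermonde big_ord_recr /= [X in _ * X]big_pred0; last first.
    by move=> k; rewrite ltnNge -ltnS ltn_ord.
  rewrite mulr1 -mul_polyC rmorph_prod -big_split; apply: eq_bigr => i _ /=.
  rewrite big_mkcond big_ord_recr /= ltn_ord zm zw rmorph_prod; congr (_ * _).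
  by rewrite [RHS]big_mkcond; apply: eq_bigr => k _; rewrite zw rmorphB.
have cofr (k : 'I_d.+1) :
    cofactor (Vandermonde d.+1 z) k ord_max
    = ((-1) ^+ (k + d) * \det (\matrix_(i < d, l < d) y i ^+ bump k l))%:P.
  rewrite /cofactor rmorphM rmorphXn rmorphN1 -det_map_mx -det_tr.
  by congr (_ * \det _); apply/matrixP => i l; rewrite 4!mxE zl !mxE rmorphXn.
have /(congr1 (fun p : {poly C} => p`_r)) := detPQ.
rewrite (expand_det_col _ ord_max) coef_sum coefZ (bigD1 r) //= big1 ?addr0; last first.
  by move=> k neq_kr; rewrite mxE zm cofr mulrC coefCM coefXn eq_sym (inj_eq val_inj) (negPf neq_kr) mulr0.
rewrite mxE zm cofr mulrC coefCM coefXn eqxx mulr1.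
have le_rd : (r <= d)%N by rewrite -ltnS.
(* Vieta's formula. *)
have -> : Q`_r = (-1) ^+ (d - r) * mpoly.meval y (mpoly.mesym d C (d - r)).
  have lt_k : (d - r < d.+1)%N by rewrite ltnS leq_subr.
  have := mpoly.mroots_coeff (mktuple y) (Ordinal lt_k); rewrite /= subKn // big_map big_enum.
  by move=> ->; congr (_ * _); apply: mpoly.meval_eq => ?; rewrite tnth_mktuple.
(* The sign of the cofactor, r + d, and Vieta's sign, d - r, have the same parity. *)
have -> : (r + d = d - r + r.*2)%N by rewrite -addnn addnA subnK // addnC.
rewrite exprD -mul2n exprM sqrrN expr1n expr1n mulr1 mulrCA.
exact: (can_inj (signrMK _)).
Qed.

(** * The matrices V_S^E and the sign epsilon *)

Lemma nth_enum_setT (d k : nat) :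
  (k < d)%N -> nth 0%N [seq val e | e <- enum [set: 'I_d]] k = k.
Proof. by move=> lt_kd; rewrite enum_setT -enumT val_enum_ord nth_iota. Qed.

Lemma nth_enum_Eset (q k : nat) (r : 'I_q) :
  (k < q.-1)%N -> nth 0%N [seq val e | e <- enum (Eset r)] k = bump r k.
Proof.
move=> lt_k; suff -> : [seq val e | e <- enum (Eset r)] = [seq bump r i | i <- iota 0 q.-1].
  by rewrite (nth_map 0%N) ?size_iota // nth_iota.
apply: (irr_sorted_eq ltn_trans ltnn).
- rewrite -[enum _]map_id /enum_mem sorted_map map_id.
  apply: sorted_filter; first by move=> ? ? ?; apply: ltn_trans.
  by rewrite -sorted_map -enumT val_enum_ord iota_ltn_sorted.
- rewrite sorted_map (@sub_sorted _ ltn) ?iota_ltn_sorted //.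
  by move=> u v /= lt_uv; rewrite ltnNge leq_bump2 -ltnNge.
move=> u; apply/mapP/mapP => [[] e|[] i].
  rewrite mem_enum !inE => neq_er ->; exists (unbump r e); last by rewrite unbumpK.
  rewrite mem_iota /= add0n /unbump; have := ltn_ord e; have := ltn_ord r.
  by move: neq_er; rewrite -val_eqE /=; lia.
rewrite mem_iota add0n => /= lt_iq ->.
have lt_b : (bump r i < q)%N by rewrite /bump; lia.
exists (Ordinal lt_b) => //.
by rewrite mem_enum !inE -val_eqE /= eq_sym neq_bump.
Qed.

Lemma vandermondeE (C : comNzRingType) (n : nat) (x : 'I_n -> C) (S : {set 'I_n}) :
  vandermonde x S = \matrix_(i < #|S|, k < #|S|) x (enum_val i) ^+ k.
Proof. by apply/matrixP => i k; rewrite !mxE nth_enum_setT. Qed.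

Lemma gen_vandermonde_EsetE (C : comNzRingType) (n q : nat) (x : 'I_n -> C)
    (S : {set 'I_n}) (r : 'I_q) : #|S| = q.-1 ->
  gen_vandermonde x S (Eset r) = \matrix_(i < #|S|, k < #|S|) x (enum_val i) ^+ bump r k.
Proof. by move=> cardS; apply/matrixP => i k; rewrite !mxE nth_enum_Eset // -cardS. Qed.

Lemma det_gen_vandermonde_Eset (C : idomainType) (n q : nat) (x : 'I_n -> C)
    (S : {set 'I_n}) (r : 'I_q) : #|S| = q.-1 ->
  \det (gen_vandermonde x S (Eset r)) = diff_prod x S * elem_sym x S (q - r.+1).
Proof.
move=> cardS; rewrite gen_vandermonde_EsetE //.
have def_q : q = #|S|.+1 by rewrite cardS prednK // (leq_trans _ (ltn_ord r)).
have lt_r : (r < #|S|.+1)%N by rewrite -def_q.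
rewrite (det_vandermonde_gap _ (Ordinal lt_r)) /elem_sym {2}def_q subSS; congr (_ * _).
rewrite /diff_prod [RHS]big_enum_val; apply: eq_bigr => i _.
by rewrite [RHS]big_enum_val_cond; apply: eq_bigl => k; rewrite enum_val_ltn.
Qed.

(** The number of elements of R_j below t is rho_j(t), and the number of
    elements of T below its k-th element is k; the difference counts the
    elements of T' = R_j \ T below t. *)
Lemma epsE (C : comNzRingType) (n : nat) (j : 'I_n) (T : {set 'I_n}) :
  T \subset Rset j ->
  eps C j T = (-1) ^+ (\sum_(t in T) \sum_(u in Rset j :\: T) (u < t)%N).
Proof.
move=> /subsetP sTR; rewrite /eps; congr (_ ^+ _); rewrite [RHS]big_enum_val.
apply: eq_bigr => k _; set t := enum_val k.
have rank_T : (\sum_(u in T) (u < t)%N = k)%N.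
  rewrite big_enum_val (eq_bigr (fun i : 'I_#|T| => (i < k)%N : nat)) => [|i _]; last first.
    by rewrite enum_val_ltn.
  rewrite -big_mkcond -(big_ord_widen _ (fun _ => 1%N)) 1?ltnW //.
  by rewrite sum1_card card_ord.
have rank_all : (\sum_(u : 'I_n) (u < t)%N = t)%N.
  rewrite -big_mkcond -(big_ord_widen _ (fun _ => 1%N)) 1?ltnW //.
  by rewrite sum1_card card_ord.
have split_R : (\sum_(u in Rset j) (u < t)%N =
    \sum_(u in T) (u < t)%N + \sum_(u in Rset j :\: T) (u < t)%N)%N.
  rewrite (bigID (mem T)) /=; congr (_ + _)%N; apply: eq_bigl => u; last by rewrite !inE andbC.
  by apply/andP/idP => [[] //|uT]; rewrite uT sTR.
have : ((j < t)%N + \sum_(u in Rset j) (u < t)%N = t)%N.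
  by rewrite -[RHS]rank_all [RHS](bigD1 j) //=; congr (_ + _)%N; apply: eq_bigl => u; rewrite !inE.
rewrite split_R rank_T /rho /unbump; lia.
Qed.

(** * Expansion of the minors *)

Lemma det_scale_rows (C : comPzRingType) (n : nat) (c : 'I_n -> C) (F : 'I_n -> 'I_n -> C) :
  \det (\matrix_(i, k) (c i * F i k)) = (\prod_i c i) * \det (\matrix_(i, k) F i k).
Proof.
have -> : \matrix_(i, k) (c i * F i k) = diag_mx (\row_i c i) *m \matrix_(i, k) F i k.
  by rewrite mul_diag_mx; apply/matrixP => i k; rewrite !mxE.
by rewrite det_mulmx det_diag; congr (_ * _); apply: eq_bigr => i _; rewrite mxE.
Qed.

(** Both cases of the theorem are instances: f and g list the exponents of the
    alpha-block and of the beta-block, one of them being the identity and the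
    other skipping the deleted exponent. *)
Lemma laplace_power_blocks (C : comNzRingType) (p a : nat) (alpha beta x : 'I_p -> C)
    (j : 'I_p) (f g : nat -> nat) : (a <= p.-1)%N ->
  \det (\matrix_(i < p.-1, k < p.-1)
     if (k < a)%N then alpha (lift j i) * x (lift j i) ^+ f k
     else beta (lift j i) * x (lift j i) ^+ g (k - a)%N) =
  \sum_(T : {set 'I_p} | (T \subset Rset j) && (#|T| == a))
     eps C j T * (\prod_(i in T) alpha i) * (\prod_(i in Rset j :\: T) beta i)
     * \det (\matrix_(i < #|T|, k < #|T|) x (enum_val i) ^+ f k)
     * \det (\matrix_(i < #|Rset j :\: T|, k < #|Rset j :\: T|) x (enum_val i) ^+ g k).
Proof.
move=> le_ap.
have lift_mono : {mono lift j : i k / (i < k)%N} by move=> i k; rewrite !ltnNge leq_bump2.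
have lift_im : lift j @: [set: 'I_p.-1] = Rset j.
  apply/setP => u; rewrite !inE; apply/imsetP/idP => [[] i _ ->|]; first by rewrite eq_sym neq_lift.
  by rewrite eq_sym => /unlift_some[i -> _]; exists i.
rewrite (laplace_two_blocks (fun i k => alpha i * x i ^+ f k)
  (fun i k => beta i * x i ^+ g k) lift_mono le_ap) lift_im.
apply: eq_bigr => T /andP[sTR _]; rewrite epsE // !det_scale_rows -!big_enum_val.
by rewrite -!mulrA; congr (_ * (_ * _)); rewrite mulrCA.
Qed.

Theorem theorem2p5 (R : realType) (q : nat)
    (alpha beta x : 'I_(q + q) -> R[i]) (j : 'I_(q + q)) :
  (forall m : 'I_q,
     minor (block_vandermonde alpha beta x) j (lshift q m) =
       \sum_(T : {set 'I_(q + q)} | (T \subset Rset j) && (#|T| == q.-1))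
          eps R[i] j T * (\prod_(i in T) alpha i) *
          (\prod_(i in Rset j :\: T) beta i) *
          \det (gen_vandermonde x T (Eset m)) *
          \det (vandermonde x (Rset j :\: T))
     /\
     forall T : {set 'I_(q + q)}, T \subset Rset j -> #|T| = q.-1 ->
       \det (gen_vandermonde x T (Eset m)) =
         diff_prod x T * elem_sym x T (q - m.+1))
  /\
  (forall l : 'I_q,
     minor (block_vandermonde alpha beta x) j (rshift q l) =
       \sum_(T : {set 'I_(q + q)} | (T \subset Rset j) && (#|T| == q))
          eps R[i] j T * (\prod_(i in T) alpha i) *
          (\prod_(i in Rset j :\: T) beta i) *
          \det (vandermonde x T) *
          \det (gen_vandermonde x (Rset j :\: T) (Eset l))
     /\
     forall T : {set 'I_(q + q)}, T \subset Rset j -> #|T| = q ->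
       \det (gen_vandermonde x (Rset j :\: T) (Eset l)) =
         diff_prod x (Rset j :\: T) * elem_sym x (Rset j :\: T) (q - l.+1)).
Proof.
have cardRD (T : {set 'I_(q + q)}) : T \subset Rset j -> #|T| = q -> #|Rset j :\: T| = q.-1.
  by move=> sTR cardT; rewrite cardsDS // cardT cardsC1 card_ord; lia.
have colE i (k : 'I_(q + q)) : block_vandermonde alpha beta x i k =
    if (k < q)%N then alpha i * x i ^+ k else beta i * x i ^+ (k - q).
  rewrite mxE; case: splitP => u ->; rewrite mxE ?ltn_ord //.
  by rewrite addKn.
split=> [m|l]; split=> [|T sTR cardT].
- have le_a : (q.-1 <= (q + q).-1)%N by lia.
  have lt_m := ltn_ord m.
  under eq_bigr => T /andP[sTR /eqP cardT] do
    rewrite gen_vandermonde_EsetE // vandermondeE.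
  rewrite -(laplace_power_blocks alpha beta x j (bump m) id le_a).
  congr (\det _); apply/matrixP => i k; rewrite 2!mxE colE !mxE /= /bump.
  case: (ltnP k q.-1) => [lt_k|le_k]; first by rewrite ifT //; lia.
  rewrite ifF; last lia.
  by congr (_ * _ ^+ _); lia.
- exact: det_gen_vandermonde_Eset.
- have le_a : (q <= (q + q).-1)%N by have := ltn_ord l; lia.
  under eq_bigr => T /andP[sTR /eqP cardT] do
    rewrite gen_vandermonde_EsetE ?cardRD // vandermondeE.
  rewrite -(laplace_power_blocks alpha beta x j id (bump l) le_a).
  congr (\det _); apply/matrixP => i k; rewrite 2!mxE colE !mxE /= /bump.
  case: (ltnP k q) => [lt_k|le_k]; first by rewrite ifT; [congr (_ * _ ^+ _)|]; lia.
  rewrite ifF; last lia.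
  by congr (_ * _ ^+ _); lia.
- by apply: det_gen_vandermonde_Eset; apply: cardRD.
Qed.
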